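(* Let $R$ be a (two-sided) perfect ring and let $T$ be a left $R$-module. Then $T$ is a sincere silting module (i.e., $T$ is both sincere and silting) if and only if $T$ is presilting and $T^{\bot_{0\le i\le 1}}=0$.
   Context: A ring $R$ is left (resp. right) perfect if every left (resp. right) $R$-module has a projective cover, and perfect if it is both. Modules are left $R$-modules, not necessarily finitely generated. $\mathrm{Add}\,T$ is the class of modules isomorphic to direct summands of (arbitrary) direct sums of copies of $T$; $\mathrm{Gen}\,T$ is the class of all epimorphic images of modules in $\mathrm{Add}\,T$. $T^{\bot_{0\le i\le 1}}$ is the class of all modules $M$ with $\mathrm{Hom}_R(T,M)=0$ and $\mathrm{Ext}^1_R(T,M)=0$; ''$T^{\bot_{0\le i\le 1}}=0$'' means that this class contains only the zero module. $T$ is sincere if $\mathrm{Hom}_R(P,T)\neq 0$ for every non-zero projective module $P$. For a morphism $\sigma$ of modules, $D_\sigma$ is the class of all modules $X$ such that the map $\mathrm{Hom}_R(\sigma,X)$ is surjective. A projective presentation of $T$ is a morphism $\sigma:P_1\to P_0$ between projective modules fitting in an exact sequence $P_1\xrightarrow{\sigma}P_0\to T\to 0$. $T$ is silting if there is a projective presentation $\sigma$ of $T$ with $\mathrm{Gen}\,T=D_\sigma$. $T$ is presilting if there is a projective presentation $\sigma$ of $T$ with $\mathrm{Gen}\,T\subseteq D_\sigma$. *)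

(* Defs.v *)
From HB Require Import structures.
From mathcomp Require Import all_boot all_order all_algebra.
From mathcomp Require Import boolp classical_sets functions cardinality.

Set Implicit Arguments.
Unset Strict Implicit.
Unset Printing Implicit Defensive.

Import GRing.Theory.
Local Open Scope ring_scope.

(* The zero ring is allowed: rings are [pzRingType].  A left [R]-module is an
   [lmodType R], and a right [R]-module is an [lmodType R^c]. *)

Section DirectSum.
Variables (R : pzRingType) (I : Type) (T : lmodType R).

Definition fin_supp : {pred I -> T} :=
  fun f => `[< finite_set [set i | f i != 0]%classic >].

Lemma fin_supp_submod_closed : submod_closed fin_supp.
Proof.
split=> [|a f g /asboolP ff /asboolP fg]; apply/asboolP.
  rewrite (_ : [set i | _]%classic = set0) ?finite_set0 //.
  by apply/seteqP; split=> i //=; rewrite eqxx.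
apply: (sub_finite_set _ (_ : finite_set
  ([set i | f i != 0] `|` [set i | g i != 0])%classic)); last first.
  by rewrite finite_setU.
move=> i /=; have -> : (a *: f + g) i = a *: f i + g i by [].
case: (eqVneq (f i) 0) => [-> /=|]; last by left.
by rewrite scaler0 add0r; right.
Qed.

HB.instance Definition _ :=
  GRing.isSubmodClosed.Build R (I -> T) fin_supp fin_supp_submod_closed.

(* The direct sum T^(I) of copies of T indexed by I. *)
Record dsum := DSum { dsum_val :> I -> T; _ : dsum_val \in fin_supp }.

HB.instance Definition _ := [isSub for dsum_val].
HB.instance Definition _ := [Choice of dsum by <:].
HB.instance Definition _ := [SubChoice_isSubLmodule of dsum by <:].

End DirectSum.

Section Modules.
Variable R : pzRingType.
Implicit Types M N P T X : lmodType R.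

Definition surjective (A B : Type) (f : A -> B) : Prop :=
  forall y, exists x, f x = y.

Definition zero_module M : Prop := forall x : M, x = 0.

Definition exact_at (L M N : lmodType R) (f : L -> M) (g : M -> N) : Prop :=
  forall x : M, g x = 0 <-> exists y : L, f y = x.

Definition projective P : Prop :=
  forall (M N : lmodType R) (g : {linear M -> N}) (f : {linear P -> N}),
    surjective g -> exists h : {linear P -> M}, g \o h =1 f.

Definition superfluous M (K : {pred M}) : Prop :=
  forall U : {pred M}, submod_closed U ->
    (forall x, exists u k, [/\ u \in U, k \in K & x = u + k]) ->
    forall x, x \in U.

Definition has_projective_cover M : Prop :=
  exists (P : lmodType R) (p : {linear P -> M}),
    [/\ projective P, surjective p & superfluous [pred x | p x == 0]].

Definition Hom_zero M N : Prop :=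
  forall (f : {linear M -> N}) (x : M), f x = 0.

(* ... -> res 2 -> res 1 -> res 0 -> T -> 0 *)
Record proj_resolution T := ProjResolution {
  res :> nat -> lmodType R;
  res_d : forall n, {linear res n.+1 -> res n};
  res_aug : {linear res 0 -> T};
  res_proj : forall n, projective (res n);
  res_aug_surj : surjective res_aug;
  res_exact0 : exact_at (res_d 0) res_aug;
  res_exact : forall n, exact_at (res_d n.+1) (res_d n) }.

(* Ext^1(T, M) = H^1(Hom(Q, M)) for a projective resolution Q of T; it vanishes
   when every 1-cocycle is a 1-coboundary.  Up to isomorphism it does not depend
   on Q, and every module has a projective (even free) resolution. *)
Definition Ext1_zero T M : Prop :=
  forall (Q : proj_resolution T) (f : {linear Q 1%N -> M}),
    (forall x, f (res_d Q 1 x) = 0) ->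
    exists g : {linear Q 0%N -> M}, forall x, f x = g (res_d Q 0 x).

Definition perp01 T M : Prop := Hom_zero T M /\ Ext1_zero T M.

Definition Add T M : Prop :=
  exists (I : Type) (N : lmodType R) (f : {linear (M * N)%type -> dsum I T}),
    bijective f.

Definition Gen T M : Prop :=
  exists (A : lmodType R) (f : {linear A -> M}), Add T A /\ surjective f.

Definition sincere T : Prop :=
  forall P, projective P -> ~ zero_module P -> ~ Hom_zero P T.

Definition D_class (P1 P0 : lmodType R) (s : {linear P1 -> P0}) X : Prop :=
  forall f : {linear P1 -> X}, exists g : {linear P0 -> X}, g \o s =1 f.

Definition proj_presentation (P1 P0 : lmodType R) (s : {linear P1 -> P0}) T
    : Prop :=
  [/\ projective P1, projective P0 &
      exists p : {linear P0 -> T}, exact_at s p /\ surjective p].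

Definition silting T : Prop :=
  exists (P1 P0 : lmodType R) (s : {linear P1 -> P0}),
    proj_presentation s T /\ forall M, Gen T M <-> D_class s M.

Definition presilting T : Prop :=
  exists (P1 P0 : lmodType R) (s : {linear P1 -> P0}),
    proj_presentation s T /\ forall M, Gen T M -> D_class s M.

End Modules.

Definition left_perfect (R : pzRingType) : Prop :=
  forall M : lmodType R, has_projective_cover M.

Definition right_perfect (R : pzRingType) : Prop := left_perfect R^c.

Definition perfect (R : pzRingType) : Prop := left_perfect R /\ right_perfect R.

(* Main.v *)
Require Import Defs.
From HB Require Import structures.
From mathcomp Require Import all_boot all_order all_algebra.
From mathcomp Require Import boolp classical_sets functions cardinality fsbigop.

Set Implicit Arguments.
Unset Strict Implicit.
Unset Printing Implicit Defensive.

Import GRing.Theory.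
Local Open Scope ring_scope.

(** Write A for the annihilator of T, a two-sided ideal, and fix a projective
presentation s : P1 -> P0 of T.

Perfectness enters chiefly through one fact ([nakayama_perfect]): over a left perfect
ring, a two-sided ideal A without nonzero idempotents satisfies Nakayama's
lemma for all modules, A M = M implies M = 0.  For such an A, each 1 - a is
invertible because the projective cover of R / R (1 - a) is R e for an
idempotent e in A; Nakayama's lemma then holds for projective modules by
computing in coordinates, and for arbitrary ones by passing to a projective
cover.  Two consequences tie sincerity to A.  First, T is sincere if and only
if A has no nonzero idempotent ([no_idempotent_of_sincere],
[sincere_of_no_idempotent]): an idempotent e of A gives Hom(R e, T) = e T = 0,
and Hom(P, T) = 0 forces P = A P by the dual basis lemma.  Second, Nakayama's
lemma for right modules makes A right T-nilpotent, so a left module in which A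
kills no nonzero element is zero ([right_perfect_annihilated_eq0]).

Suppose that T is sincere and silting with Gen T = D_s, and that
Hom(T, M) = Ext^1(T, M) = 0.  Let U be the submodule of elements of M killed by
A, and V the preimage in M of the trace of T in M / U.  Every map P1 -> U
vanishes on the kernel of s ([presentation_ker_ann]), so it extends along s to
P0 -> M since Ext^1(T, M) = 0, and this extension takes its values in V.  Hence
V, an extension of that trace by U, lies in D_s = Gen T; as Hom(T, M) = 0, V = 0
and so U = 0 ([perp01_annihilated_eq0]), and M = 0 by T-nilpotence.

Conversely let T be presilting with Gen T contained in D_s, and suppose that
only 0 is orthogonal to T.  If e is an idempotent of A, the coinduced module
Hom_(eRe)(eR, eR) is orthogonal to every module killed by e ([coind_perp]), so
it is 0 and e = 0; hence T is sincere.  If X lies in D_s and tX is the trace of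
T in X, then X / tX is orthogonal to T ([Hom_zero_mod_trace], [D_class_Ext1]),
so X = tX lies in Gen T; hence T is silting for the same s. *)

(** * Submodules, quotients and factorization of linear maps *)

Definition linear_pack (R : pzRingType) (M N : lmodType R) (f : M -> N)
    (lf : linear f) : {linear M -> N} :=
  HB.pack f (GRing.isLinear.Build R M N *:%R f lf).

Definition is_submod (R : pzRingType) (M : lmodType R) (U : M -> Prop) : Prop :=
  U 0 /\ forall a x y, U x -> U y -> U (a *: x + y).

Section SubQuotient.
Variables (R : pzRingType) (M : lmodType R) (U : M -> Prop).
Hypothesis sU : is_submod U.

Definition submod_pred of is_submod U : {pred M} := fun x => `[< U x >].

Lemma submod_pred_closed : submod_closed (submod_pred sU).
Proof.
case: (sU) => U0 UD; split=> [|a x y /asboolP Ux /asboolP Uy]; apply/asboolP => //.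
exact: UD.
Qed.

HB.instance Definition _ :=
  GRing.isSubmodClosed.Build R M (submod_pred sU) submod_pred_closed.

Record submodule :=
  Submodule { submodule_val : M; _ : submodule_val \in submod_pred sU }.

HB.instance Definition _ := [isSub for submodule_val].
HB.instance Definition _ := [Choice of submodule by <:].
HB.instance Definition _ := [SubChoice_isSubLmodule of submodule by <:].

Definition quotmod := Quotient.quot (submod_pred sU).
HB.instance Definition _ := GRing.Zmodule.on quotmod.

Definition quot_pi : M -> quotmod := pi (Quotient.quot (submod_pred sU)).

Definition quot_scale (a : R) (x : quotmod) : quotmod := quot_pi (a *: repr x).

Lemma quot_pi_zmod_morphism : zmod_morphism quot_pi.
Proof. by move=> x y; rewrite /quot_pi raddfB. Qed.

HB.instance Definition _ :=
  GRing.isZmodMorphism.Build M quotmod quot_pi quot_pi_zmod_morphism.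

Lemma quot_pi_eq0 x : quot_pi x = 0 <-> U x.
Proof.
rewrite -(raddf0 quot_pi) -[x in U x]subr0; split=> [/eqP | Ux]; last apply/eqP.
  by rewrite -Quotient.idealrBE => /asboolP.
by rewrite -Quotient.idealrBE; apply/asboolP.
Qed.

Lemma quot_pi_eq x y : quot_pi x = quot_pi y <-> U (x - y).
Proof.
have E : quot_pi (x - y) = quot_pi x - quot_pi y by apply: raddfB.
by rewrite -quot_pi_eq0 E; split=> [->|/eqP]; [rewrite subrr | rewrite subr_eq0 => /eqP].
Qed.

Lemma quot_reprK x : quot_pi (repr x) = x.
Proof. exact: reprK. Qed.

Lemma quot_pi_scale a x : quot_pi (a *: x) = quot_scale a (quot_pi x).
Proof.
apply/quot_pi_eq; rewrite -scalerBr -[_ *: _]addr0.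
have [U0 UD] := sU; apply: (UD) => //.
by apply/quot_pi_eq; rewrite quot_reprK.
Qed.

Fact quot_scalerA a b x : quot_scale a (quot_scale b x) = quot_scale (a * b) x.
Proof. by rewrite -[x]quot_reprK -!quot_pi_scale scalerA. Qed.
Fact quot_scale1r : left_id 1 quot_scale.
Proof. by move=> x; rewrite -[x]quot_reprK -!quot_pi_scale scale1r. Qed.
Fact quot_scalerDr : right_distributive quot_scale +%R.
Proof.
by move=> a x y; rewrite -[x]quot_reprK -[y]quot_reprK -raddfD -!quot_pi_scale
  scalerDr raddfD.
Qed.
Fact quot_scalerDl x : {morph quot_scale^~ x : a b / a + b}.
Proof. by move=> a b; rewrite -[x]quot_reprK -!quot_pi_scale scalerDl raddfD. Qed.

HB.instance Definition _ := GRing.Zmodule_isLmodule.Build R quotmod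
  quot_scalerA quot_scale1r quot_scalerDr quot_scalerDl.

Lemma submodule_exists : exists (S : lmodType R) (i : {linear S -> M}),
  injective i /\ forall x, U x <-> exists y, i y = x.
Proof.
exists submodule, (\val : {linear submodule -> M}); split; first exact: val_inj.
move=> x; split=> [xU|[y <-]]; last exact/asboolP/(valP y).
by exists (Submodule (asboolT xU : x \in submod_pred sU)).
Qed.

Lemma quotient_exists : exists (Q : lmodType R) (p : {linear M -> Q}),
  surjective p /\ forall x, p x = 0 <-> U x.
Proof.
have lp : linear quot_pi by move=> a x y; rewrite raddfD /= quot_pi_scale.
exists quotmod, (linear_pack lp); split=> [y|x]; last exact: quot_pi_eq0.
by exists (repr y); apply: quot_reprK.
Qed.

End SubQuotient.

Section LinearMaps.
Variable R : pzRingType.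
Implicit Types L M N P : lmodType R.

Lemma is_submod_image M N (f : {linear M -> N}) (U : M -> Prop) :
  is_submod U -> is_submod (fun y => exists2 x, U x & f x = y).
Proof.
case=> U0 UD; split=> [|a _ _ [x Ux <-] [y Uy <-]]; first by exists 0; rewrite ?linear0.
by exists (a *: x + y); [exact: UD | rewrite linearP].
Qed.

Lemma is_submod_range M N (f : {linear M -> N}) :
  is_submod (fun y => exists x, f x = y).
Proof.
split=> [|a _ _ [x <-] [y <-]]; first by exists 0; rewrite linear0.
by exists (a *: x + y); rewrite linearP.
Qed.

Lemma is_submod_preim M N (f : {linear M -> N}) (U : N -> Prop) :
  is_submod U -> is_submod (fun x => U (f x)).
Proof.
case=> U0 UD; split=> [|a x y Ux Uy]; first by rewrite linear0.
by rewrite linearP; apply: UD.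
Qed.

Lemma is_submod_ker M N (f : {linear M -> N}) : is_submod (fun x => f x = 0).
Proof.
apply: (@is_submod_preim M N f (fun x => x = 0)).
by split=> // a x y -> ->; rewrite scaler0 addr0.
Qed.

Lemma factor_injective L M N (i : {linear M -> N}) (f : {linear L -> N}) :
  injective i -> (forall x, exists y, i y = f x) ->
  exists g : {linear L -> M}, forall x, i (g x) = f x.
Proof.
move=> inji /choice[g gE].
have lg : linear g by move=> a x y; apply: inji; rewrite gE !linearP !gE.
by exists (linear_pack lg).
Qed.

Lemma factor_surjective L M N (p : {linear L -> M}) (f : {linear L -> N}) :
  surjective p -> (forall x, p x = 0 -> f x = 0) ->
  exists g : {linear M -> N}, forall x, g (p x) = f x.
Proof.
move=> /choice[s sE] kf.
have fE x y : p x = p y -> f x = f y.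
  move=> e; apply/eqP; rewrite -subr_eq0 -linearB kf ?linearB /= ?e ?subrr//.
have lg : linear (f \o s).
  by move=> a x y /=; rewrite -linearP; apply: fE; rewrite linearP !sE.
by exists (linear_pack lg) => x /=; apply: fE; rewrite sE.
Qed.

Lemma projective_lift P M N (g : {linear M -> N}) (f : {linear P -> N}) :
  projective P -> (forall x, exists y, g y = f x) ->
  exists h : {linear P -> M}, forall x, g (h x) = f x.
Proof.
move=> pP fg.
have [S [i [inji iE]]] := submodule_exists (is_submod_range g).
have [|f' f'E] := @factor_injective P S N i f inji.
  by move=> x; apply/iE; apply: fg.
have [|g' g'E] := @factor_injective M S N i g inji.
  by move=> x; apply/iE; exists x.
have [|h hE] := pP M S g' f'.
  move=> y; have /iE[x xE] : exists z, i z = i y by exists y.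
  by exists x; apply: inji; rewrite g'E.
by exists h => x; rewrite -g'E -f'E -hE.
Qed.

End LinearMaps.

(** * Direct sums, Gen T and the trace of T *)

Section DirectSums.
Variables (R : pzRingType) (I : choiceType) (T : lmodType R).
Implicit Types (y : dsum I T) (r : seq I).

Lemma dsum_supp y : exists2 r, uniq r & forall i, i \notin r -> y i = 0.
Proof.
case: y => f /= /asboolP/finite_seqP[s sE]; exists (undup s); first exact: undup_uniq.
move=> i; rewrite mem_undup => /negP ni; apply/eqP/negPn/negP => fi.
by apply: ni; have : [set` s]%classic i by rewrite -sE.
Qed.

Lemma fin_supp_seq (f : I -> T) r : (forall i, i \notin r -> f i = 0) ->
  f \in @fin_supp R I T.
Proof.
move=> fr; apply/asboolP; apply: (sub_finite_set _ (finite_seq r)) => i /= fi.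
by apply: contraNT fi => /fr ->.
Qed.

Lemma dsum_coord_linear i : linear (fun y => y i : T).
Proof. by []. Qed.

Lemma dsum_single_supp (i : I) (t : T) :
  (fun j => if j == i then t else 0) \in @fin_supp R I T.
Proof.
by apply: (@fin_supp_seq _ [:: i]) => j; rewrite inE => /negbTE ->.
Qed.

Definition dsum_single i t : dsum I T := DSum (dsum_single_supp i t).

Lemma dsum_single_linear i : linear (dsum_single i).
Proof.
move=> a x y; apply/val_inj/funext => j.
rewrite -[RHS]/(a *: dsum_single i x j + dsum_single i y j) /=.
by case: eqP; rewrite ?scaler0 ?addr0.
Qed.

Lemma dsum_decomp y r : uniq r -> (forall i, i \notin r -> y i = 0) ->
  y = \sum_(i <- r) dsum_single i (y i).
Proof.
move=> ur yr; apply/val_inj/funext => j.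
rewrite -[RHS]/(linear_pack (dsum_coord_linear j) _) linear_sum /=.
have [jr|jr] := boolP (j \in r).
  by rewrite (bigD1_seq j) //= eqxx big1 ?addr0 // => i; rewrite eq_sym => /negbTE ->.
rewrite yr// big_seq big1 // => i ir; case: eqP => // e.
by rewrite -e in ir; rewrite ir in jr.
Qed.

Variables (X : lmodType R) (g : I -> {linear T -> X}).

(** The universal property of the direct sum: the sum may be taken over any
finite list covering the support, which makes additivity a computation over
a common list. *)
Lemma dsum_sum : exists f : {linear dsum I T -> X}, forall y r,
  uniq r -> (forall i, i \notin r -> y i = 0) -> f y = \sum_(i <- r) g i (y i).
Proof.
have /choice[h hE] y : exists x, forall r,
    uniq r -> (forall i, i \notin r -> y i = 0) -> x = \sum_(i <- r) g i (y i).
  exists (\sum_(i \in [set: I]) g i (y i)) => r ur yr.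
  rewrite (fsbigE r) //; last by move=> i _ /yr ->; rewrite linear0.
  by apply: eq_bigl => i; rewrite in_setT.
have lh : linear h.
  move=> a x y; have [r ur rE] := dsum_supp x; have [s us sE] := dsum_supp y.
  have ut := undup_uniq (r ++ s); set t := undup _ in ut.
  have xt i : i \notin t -> x i = 0.
    by rewrite mem_undup mem_cat => /norP[/rE].
  have yt i : i \notin t -> y i = 0.
    by rewrite mem_undup mem_cat => /norP[_ /sE].
  have E i : dsum_val (a *: x + y : dsum I T) i = a *: x i + y i by [].
  have zt i : i \notin t -> dsum_val (a *: x + y : dsum I T) i = 0.
    by move=> it; rewrite E xt // yt // scaler0 addr0.
  rewrite (hE _ t ut zt) (hE x t ut xt) (hE y t ut yt) scaler_sumr -big_split /=.
  by apply: eq_bigr => i _; rewrite -linearP.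
by exists (linear_pack lh).
Qed.

End DirectSums.

Section GenTrace.
Variable R : pzRingType.
Implicit Types T M N X : lmodType R.

Lemma Hom_zero_dsum (I : Type) T N : Hom_zero T N -> Hom_zero (dsum I T) N.
Proof.
move=> h f; have E : forall y : dsum {classic I} T, f y = 0; last exact: E.
move=> y; have [r ur rE] := dsum_supp y.
rewrite (dsum_decomp ur rE) linear_sum big1 // => i _.
exact: (h (f \o linear_pack (@dsum_single_linear R {classic I} T i))).
Qed.

Lemma Gen_Hom_zero T M N : Gen T M -> Hom_zero T N -> Hom_zero M N.
Proof.
move=> [A [p [[I [B [b [c bc cb]]]] sp]]] h f x.
have [a <-] := sp x.
have lc : linear c.
  by move=> k u v; apply: (can_inj bc); rewrite linearP !cb.
have := Hom_zero_dsum h (f \o p \o fst \o linear_pack lc) (b (a, 0)).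
by rewrite /= bc.
Qed.

Lemma Gen_image T M N (p : {linear M -> N}) : surjective p -> Gen T M -> Gen T N.
Proof.
move=> sp [A [q [aA sq]]]; exists A, (p \o q); split=> // y.
by have [x <-] := sp y; have [a <-] := sq x; exists a.
Qed.

Lemma Gen_dsum (I : Type) T : Gen T (dsum I T).
Proof.
(* The complement is the zero module, realized as row vectors of length 0. *)
have l1 : linear (fun x : dsum I T * 'rV[R]_0 => x.1) by [].
exists (dsum I T), idfun; split; last by move=> y; exists y.
exists I, 'rV[R]_0, (linear_pack l1), (fun x => (x, 0)) => [[x z]|//].
by rewrite /= [z]thinmx0.
Qed.

(** S is the trace of T in X, the image of the direct sum of copies of T
indexed by Hom(T, X). *)
Lemma trace_Gen T X : exists (S : lmodType R) (i : {linear S -> X}),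
  [/\ injective i, Gen T S & forall (f : {linear T -> X}) t, exists s, i s = f t].
Proof.
have [p pE] := dsum_sum (fun f : {classic {linear T -> X}} => f : {linear T -> X}).
have [S [i [inji iE]]] := submodule_exists (is_submod_range p).
exists S, i; split => // [|f t].
  have [|q qE] := @factor_injective R _ S X i p inji.
    by move=> x; apply/iE; exists x.
  apply: (@Gen_image _ _ _ q); last exact: Gen_dsum.
  move=> s; have /iE[y yE] : exists z, i z = i s by exists s.
  by exists y; apply: inji; rewrite qE.
apply/iE; exists (dsum_single (f : {classic {linear T -> X}}) t).
rewrite (pE _ [:: f : {classic _}]) ?big_seq1 //= ?eqxx // => g.
by rewrite inE => /negbTE ->.
Qed.

Lemma Gen_self T : Gen T T.
Proof.
have [S [i [inji gS iT]]] := trace_Gen T T.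
apply: (@Gen_image _ _ _ i) gS => t; have [s st] := iT idfun t.
by exists s; rewrite st.
Qed.

End GenTrace.

(** * Nakayama's lemma over left perfect rings *)

Section Annihilation.
Variable R : pzRingType.
Implicit Types M N P T : lmodType R.

Record ideal (A : R -> Prop) : Prop := Ideal {
  ideal0 : A 0;
  idealD : forall a b, A a -> A b -> A (a + b);
  idealMl : forall r a, A a -> A (r * a);
  idealMr : forall r a, A a -> A (a * r) }.

Definition no_idempotent (A : R -> Prop) : Prop :=
  forall e, A e -> e * e = e -> e = 0.

(** This is A M = M: the submodule A M is the intersection of all the
submodules that contain every a *: x with a in A. *)
Definition ideal_generates (A : R -> Prop) M : Prop :=
  forall U : M -> Prop, is_submod U ->
    (forall a x, A a -> U (a *: x)) -> forall x, U x.

Variable A : R -> Prop.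
Hypothesis iA : ideal A.

Lemma superfluousP M N (p : {linear M -> N}) (U : M -> Prop) :
  superfluous [pred x | p x == 0] -> is_submod U ->
  (forall x, exists2 u, U u & p u = p x) -> forall x, U x.
Proof.
move=> sp sU Up x; apply/asboolP.
apply: (sp _ (submod_pred_closed sU)) => y; have [u Uu uy] := Up y.
exists u, (y - u); split; first exact/asboolP.
  by rewrite inE linearB /= uy subrr.
by rewrite addrC subrK.
Qed.

Lemma ideal_generates_cover M P (p : {linear P -> M}) :
  surjective p -> superfluous [pred x | p x == 0] ->
  ideal_generates A M -> ideal_generates A P.
Proof.
move=> sp kp AM U sU AU; apply: (superfluousP kp sU) => x.
apply: (AM _ (is_submod_image p sU)) => a y Aa.
by have [z <-] := sp y; exists (a *: z); [exact: AU | rewrite linearZ].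
Qed.

(** The preimage of A under a linear form is a submodule because A is a left
ideal, and contains A M because A is a right ideal. *)
Lemma ideal_generates_coord M (s : {linear M -> R^o}) :
  ideal_generates A M -> forall x, A (s x).
Proof.
case: (iA) => A0 AD AMl AMr AM.
apply: AM => [|a x Aa]; last by rewrite linearZ; apply: AMr.
by split=> [|a x y sx sy]; rewrite ?linear0 // linearP; apply/AD/sy/AMl.
Qed.

Lemma linear_scaler M (x : M) : linear (fun r : R^o => (r : R) *: x).
Proof. by move=> a u v /=; rewrite scalerDl -scalerA. Qed.

(** The module N = R / R (1 - a) satisfies A N = N, since a acts as the
identity on the class of 1.  Its projective cover P is a direct summand of R,
hence generated by an idempotent, which lies in A because A P = P. *)
Lemma left_inverse_of_no_idempotent : left_perfect R -> no_idempotent A ->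
  forall a, A a -> exists b, b * (1 - a) = 1.
Proof.
case: (iA) => A0 AD AMl AMr pR idA a Aa.
have [N [q [sq kq]]] := quotient_exists (is_submod_range
  (linear_pack (@linear_scaler R^o (1 - a)))).
have qa (r : R^o) : q r = q (r * a : R).
  apply/eqP; rewrite -subr_eq0 -linearB; apply/eqP/kq; exists r => /=.
  by rewrite -[LHS]/(r * (1 - a)) mulrBr mulr1.
have AN : ideal_generates A N.
  move=> U sU AU y; have [r <-] := sq y; rewrite qa.
  by rewrite -[r * a]mulr1 -[_ * 1]/((r * a) *: (1 : R^o)) linearZ; apply/AU/AMl.
have [P [p [pP sp kp]]] := pR N.
have AP := ideal_generates_cover sp kp AN.
(* The projection R -> N lifts to k : R -> P, which is onto since the kernel of
   the cover is superfluous, and which splits since P is projective. *)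
have [k kE] : exists k : {linear R^o -> P}, forall x, p (k x) = q x.
  have [y yE] := sp (q 1).
  exists (linear_pack (linear_scaler y)) => x /=.
  by rewrite linearZ yE -linearZ -[_ *: _]/(x * 1) mulr1.
have sk : surjective k.
  move=> y; apply: (superfluousP kp (is_submod_range k)) => x.
  have [r rE] := sq (p x); exists (k r); first by exists r.
  by rewrite kE.
have [s sE] := pP _ _ k idfun sk.
have e0 : s (k 1) = 0.
  apply: idA; first exact: ideal_generates_coord.
  rewrite -[_ * _]/(s (k 1) *: (s (k 1) : R^o)) -!linearZ.
  by rewrite -[_ *: _]/(s (k 1) * 1) mulr1; congr (s _); exact: sE.
have k1 : k 1 = 0 by rewrite -[k 1](sE) /= e0 linear0.
have [|b bE] := (kq 1).1; first by rewrite -kE k1 linear0.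
by exists b.
Qed.

Lemma two_sided_inverse : (forall a, A a -> exists b, b * (1 - a) = 1) ->
  forall a, A a -> exists b, (1 - a) * b = 1.
Proof.
case: (iA) => A0 AD AMl AMr inv a Aa.
have [b ba] := inv a Aa.
have [c cb] : exists c, c * b = 1.
  have [|c cE] := inv (- (b * a)); first by rewrite -mulNr; apply: AMl.
  exists c; rewrite -cE opprK; congr (_ * _).
  by rewrite -ba mulrBr mulr1 subrK.
exists b; have : c * (b * (1 - a)) = c by rewrite ba mulr1.
by rewrite mulrA cb mul1r => ->.
Qed.

(** This is Nakayama's lemma for the right ideal generated by the y i: one
generator after the other is eliminated, using the inverse of 1 - b k k. *)
Lemma nakayama_seq (I : eqType) (r : seq I) (y : I -> R) (b : I -> I -> R) :
  (forall a, A a -> exists b, (1 - a) * b = 1) ->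
  (forall i j, A (b i j)) -> {in r, forall j, y j = \sum_(i <- r) y i * b i j} ->
  {in r, forall j, y j = 0}.
Proof.
case: (iA) => A0 AD AMl AMr inv.
elim: r b => // k r IH b Ab yE.
have [c cE] := inv _ (Ab k k).
have yk : y k = \sum_(i <- r) y i * (b i k * c).
  have : y k * (1 - b k k) = \sum_(i <- r) y i * b i k.
    by rewrite mulrBr mulr1 {1}yE ?mem_head // big_cons addrC addrA addNr add0r.
  move/(congr1 ( *%R^~ c)); rewrite -mulrA cE mulr1 => ->.
  by rewrite mulr_suml; apply: eq_bigr => i _; rewrite mulrA.
have y0 : {in r, forall j, y j = 0}.
  apply: (IH (fun i j => b i j + b i k * c * b k j)) => [i j|j jr].
    by apply: AD => //; apply: AMl.
  rewrite yE ?inE ?jr ?orbT // big_cons yk mulr_suml -big_split /=.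
  by apply: eq_bigr => i _; rewrite mulrDr !mulrA addrC.
move=> j; rewrite inE => /orP[/eqP ->|/y0//].
by rewrite yk big_seq big1 // => i ir; rewrite y0 // mul0r.
Qed.

Lemma dual_basis P : projective P -> exists s : {linear P -> dsum P R^o},
  forall x r, uniq r -> (forall i, i \notin r -> s x i = 0) ->
    x = \sum_(i <- r) (s x i : R) *: i.
Proof.
move=> pP; have [f fE] := dsum_sum (fun i : P => linear_pack (linear_scaler i)).
have sf : surjective f.
  move=> x; exists (dsum_single x (1 : R^o)).
  rewrite (fE _ [:: x]) ?big_seq1 //= ?eqxx ?scale1r // => i.
  by rewrite inE => /negbTE ->.
have [s sE] := pP _ _ f idfun sf.
by exists s => x r ur xr; rewrite -{1}[x]sE /= (fE _ r).
Qed.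

(** For x in P with coordinates y i on a dual basis, y j is the sum of the
y i * b i j where b i j, the coordinates of the generators, lie in A because
P = A P. *)
Lemma nakayama_projective P :
  (forall a, A a -> exists b, (1 - a) * b = 1) ->
  projective P -> ideal_generates A P -> zero_module P.
Proof.
move=> inv pP AP x; have [s sE] := dual_basis pP.
have As i j : A (s i j).
  by apply: (ideal_generates_coord (linear_pack (@dsum_coord_linear R P R^o j) \o s) AP).
have [r ur rE] := dsum_supp (s x).
rewrite (sE x r ur rE) big_seq big1 // => i ir.
rewrite (@nakayama_seq _ r (fun i => s x i) (fun i j => s i j)) ?scale0r //.
move=> j jr.
pose sj : {linear P -> R^o} := linear_pack (@dsum_coord_linear R P R^o j) \o s.
apply: (etrans (congr1 sj (sE x r ur rE))); rewrite linear_sum.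
by apply: eq_bigr => k _; rewrite linearZ.
Qed.

Lemma nakayama_perfect M : left_perfect R -> no_idempotent A ->
  ideal_generates A M -> zero_module M.
Proof.
move=> pR idA AM x; have [P [p [pP sp kp]]] := pR M.
have inv := two_sided_inverse (left_inverse_of_no_idempotent pR idA).
have [y <-] := sp x.
by rewrite (nakayama_projective inv pP (ideal_generates_cover sp kp AM) y) linear0.
Qed.

End Annihilation.

(** * Sincerity and the annihilator *)

Section Sincere.
Variable R : pzRingType.
Implicit Types M P T : lmodType R.

Definition ann T (a : R) : Prop := forall t : T, a *: t = 0.

Lemma ann_ideal T : ideal (ann T).
Proof.
split=> [t|a b Aa Ab t|r a Aa t|r a Aa t]; first exact: scale0r.
- by rewrite scalerDl Aa Ab addr0.
- by rewrite -scalerA Aa scaler0.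
- by rewrite -scalerA Aa.
Qed.

(** A nonzero idempotent e killing T gives the nonzero projective module R e,
and Hom(R e, T) = e T = 0. *)
Lemma no_idempotent_of_sincere T : sincere T -> no_idempotent (ann T).
Proof.
move=> sT e Te ee; apply/eqP/negPn/negP => /eqP e0.
have [E [i [inji iE]]] := submodule_exists
  (is_submod_range (linear_pack (@linear_scaler R R^o e))).
have ie x : (i x : R) * e = i x.
  have /iE[r <-] : exists y, i y = i x by exists x.
  by rewrite /= -mulrA ee.
have [x xE] : exists x, i x = e by apply/iE; exists e.
have scx y : y = (i y : R) *: x.
  by apply: inji; rewrite linearZ xE -[RHS]/((i y : R) * e) ie.
apply: (sT E).
- move=> M N g f sg; have [m mE] := sg (f x).
  exists (linear_pack (linear_scaler m) \o i) => y /=.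
  by rewrite linearZ mE [in RHS](scx y) linearZ.
- by move=> zE; apply: e0; rewrite -xE (zE x) linear0.
move=> f y; have fx : f x = 0 by rewrite (scx x) linearZ /= xE; apply: Te.
by rewrite (scx y) linearZ /= fx scaler0.
Qed.

(** If Hom(P, T) = 0 then each coordinate form of a dual basis of P takes its
values in the annihilator A of T, so that P = A P. *)
Lemma sincere_of_no_idempotent T :
  left_perfect R -> no_idempotent (ann T) -> sincere T.
Proof.
move=> pR idT P pP nzP homP; apply: nzP.
apply: (nakayama_perfect (ann_ideal T) pR idT) => U [U0 UD] AU x.
have [s sE] := dual_basis pP; have [r ur rE] := dsum_supp (s x).
rewrite (sE x r ur rE); elim: (r) => [|i r' IH]; first by rewrite big_nil.
rewrite big_cons -[_ *: _]scale1r; apply: UD => //; apply: AU => t.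
exact: (homP (linear_pack (linear_scaler t) \o
  (linear_pack (@dsum_coord_linear R P R^o i) \o s))).
Qed.

(** If M is nonzero, elements a_n of A can be chosen one after the other with
a_n ... a_0 m0 nonzero for all n.  Bass's right module, the direct limit N of
the maps R -> R given by left multiplication by the a_n, then satisfies
N A = N; Nakayama's lemma gives N = 0, so that a_n ... a_0 = 0 for some n. *)
Lemma right_perfect_annihilated_eq0 (A : R -> Prop) M :
  right_perfect R -> ideal A -> no_idempotent A ->
  (forall m : M, (forall a, A a -> a *: m = 0) -> m = 0) -> zero_module M.
Proof.
move=> pR iA idA socM m0; apply/eqP/negPn/negP => /eqP nz.
have /choice[c cE] (m : M) : exists a, m <> 0 -> A a /\ a *: m <> 0.
  have [->|/eqP mn] := eqVneq m 0; first by exists 0.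
  apply: contra_notP mn => /forallNP na; apply: socM => a Aa.
  by apply: contra_notP (na a) => am _.
pose m n := iter n (fun x => c x *: x) m0; pose a n := c (m n).
have mn n : m n <> 0 by elim: n => //= n IH; apply: (cE _ IH).2.
have Aa n : A (a n) := (cE _ (mn n)).1.
(* w k d is the product a (k + d - 1) ... a k of d factors. *)
pose w k := fix w d : R := if d is d'.+1 then a (d' + k)%N * w d' else 1.
have w1 k d : w k d.+1 = w k.+1 d * a k.
  elim: d => [|d IH]; first by rewrite /= mulr1 mul1r.
  by rewrite -[LHS]/(a (d.+1 + k)%N * w k d.+1) IH mulrA /= addSnnS.
have wD k d d' : w k (d + d')%N = w (k + d)%N d' * w k d.
  elim: d' => [|d' IH]; first by rewrite addn0 mul1r.
  by rewrite addnS /= IH mulrA (addnC d d') -addnA (addnC d k).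
(* The limit N is realized by the sequences u such that, for some k and r,
   u (n + k) = w k n * r for all large n, modulo the eventually null ones. *)
pose W : lmodType R^c := (nat -> (R^c)^o)%type.
pose tail (u : W) k (r : R) :=
  exists n0, forall n, (n0 <= n)%N -> (u (n + k)%N : R) = w k n * r.
have tail_shift u k r j : tail u k r -> tail u (k + j)%N (w k j * r).
  case=> n0 uE; exists n0 => n n0n.
  by rewrite mulrA -wD (addnC k) addnA uE ?(leq_trans n0n) ?leq_addr // (addnC j).
have tailD u v k l r s b : tail u k r -> tail v l s ->
    tail ((b : R^c) *: u + v) (k + l)%N (w k l * r * b + w l k * s).
  move=> /(@tail_shift _ _ _ l)[n1 uE] /(@tail_shift _ _ _ k)[n2 vE].
  exists (n1 + n2)%N => n nn.
  rewrite mulrDr mulrA -uE ?(leq_trans (leq_addr _ _) nn) //.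
  by rewrite [in w (k + l)%N n * (w l k * s)]addnC -vE
    ?(leq_trans (leq_addl _ _) nn) // (addnC l).
have [S [i [inji iE]]] : exists (S : lmodType R^c) (i : {linear S -> W}),
    injective i /\ forall u, (exists k r, tail u k r) <-> exists y, i y = u.
  apply: submodule_exists; split.
    by exists 0%N, 0, 0%N => n _; rewrite mulr0.
  move=> b u v [k [r ur]] [l [s vs]].
  by exists (k + l)%N, (w k l * r * b + w l k * s); apply: tailD.
have [N [p [sp kp]]] : exists (N : lmodType R^c) (p : {linear S -> N}),
    surjective p /\ forall y, p y = 0 <-> tail (i y) 0 0.
  apply: quotient_exists; split; first by exists 0%N => n _; rewrite linear0 mulr0.
  move=> b x y tx ty; rewrite linearP.
  by have := tailD _ _ _ _ _ _ b tx ty; rewrite !mulr0 mul0r addr0.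
have stem k : exists y, tail (i y) k 1.
  pose u : W := fun n => w k (n - k)%N.
  have tu : tail u k 1 by exists 0%N => n _; rewrite mulr1 /u addnK.
  have /iE[y yE] : exists k r, tail u k r by exists k, 1.
  by exists y; rewrite yE.
have iA' : @ideal R^c A.
  by case: iA => A0 AD AMl AMr; split=> [||r b|r b]; [|exact: AD|exact: AMr|exact: AMl].
have AN : @ideal_generates R^c A N.
  move=> U sU AU x; have [y <-] := sp x.
  have /iE[k [r tyr]] : exists z, i z = i y by exists y.
  have [z tz] := stem k.+1.
  (* In the limit, the class of r at stage k is that of a k * r at stage k + 1. *)
  pose b : R := a k * r.
  suff -> : p y = (b : R^c) *: p z by apply: AU; apply: (idealMr iA).
  apply/eqP; rewrite -subr_eq0 -linearZ -linearB; apply/eqP/kp.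
  have [n1 yE] : tail (i y) k.+1 (w k 1%N * r) by rewrite -addn1; apply: tail_shift.
  have [n2 zE] := tz.
  exists (n1 + n2 + k.+1)%N => n nn.
  have kn : (k.+1 <= n)%N := leq_trans (leq_addl _ _) nn.
  have n12 : (n1 + n2 <= n - k.+1)%N by rewrite leq_subRL // addnC.
  rewrite linearB linearZ /= mulr0 -[LHS]/((i y (n + 0)%N : R) - (i z (n + 0)%N : R) * b).
  rewrite addn0 -(subnK kn) (zE _ (leq_trans (leq_addl _ _) n12)).
  by rewrite (yE _ (leq_trans (leq_addr _ _) n12)) /= mulr1 add0n mulr1 subrr.
have [y0 [n1 n1E]] := stem 0%N.
have py : p y0 = 0 by apply: (nakayama_perfect iA' pR idA AN).
have /kp[n2 n2E] := py.
have := n2E (n1 + n2)%N (leq_addl _ _).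
rewrite (n1E _ (leq_addr _ _)) mulr0 mulr1 => w0.
apply: (mn (n1 + n2)%N).
have wm n : m n = w 0%N n *: m0.
  by elim: n => [|n IH] /=; rewrite ?scale1r // -scalerA -IH addn0.
by rewrite wm w0 scale0r.
Qed.

End Sincere.

(** * Coinduction from a corner ring *)

Section Coinduced.
Variables (R : pzRingType) (e : R).

(** These are the maps obtained from the eRe-linear maps eR -> eR by composing
with x |-> e * x, when e is idempotent; the second condition makes the map
factor through eR, and the third expresses linearity over eRe as well as, at
r = 1, that the values on eR lie in eR. *)
Definition corner_maps : {pred R -> R} := fun phi => `[<
  [/\ {morph phi : x y / x - y}, forall x, phi (e * x) = phi x
    & forall r x, phi (r * e * x) = e * r * phi x] >].

Lemma corner_maps_zmod_closed : zmod_closed corner_maps.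
Proof.
split=> [|f g /asboolP[fB fe fl] /asboolP[gB ge gl]]; apply/asboolP.
  by split=> [x y|x|r x]; rewrite /= ?subrr ?mulr0.
split=> [x y|x|r x].
- by rewrite -![(f - g) _]/(f _ - g _) fB gB opprD addrACA -opprD.
- by rewrite -![(f - g) _]/(f _ - g _) fe ge.
- by rewrite -![(f - g) _]/(f _ - g _) fl gl mulrBr.
Qed.

HB.instance Definition _ :=
  GRing.isZmodClosed.Build (R -> R) corner_maps corner_maps_zmod_closed.

Record coind := Coind { coind_val :> R -> R; _ : coind_val \in corner_maps }.

HB.instance Definition _ := [isSub for coind_val].
HB.instance Definition _ := [Choice of coind by <:].
HB.instance Definition _ := [SubChoice_isSubZmodule of coind by <:].

Lemma coindP (phi : coind) : [/\ {morph phi : x y / x - y},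
  forall x, phi (e * x) = phi x & forall r x, phi (r * e * x) = e * r * phi x].
Proof. by case: phi => phi /= /asboolP. Qed.

Fact coind_scale_subproof (a : R) (phi : coind) :
  (fun x => phi (x * a)) \in corner_maps.
Proof.
have [pB pe pl] := coindP phi; apply/asboolP.
by split=> [x y|x|r x]; rewrite ?mulrBl // -?mulrA ?pe // !mulrA -?pl !mulrA.
Qed.

Definition coind_scale a phi := Coind (coind_scale_subproof a phi).

Lemma coindD (phi : coind) : {morph phi : x y / x + y}.
Proof.
have [pB _ _] := coindP phi => x y.
have p0 : phi 0 = 0 by have := pB 0 0; rewrite !subrr.
by rewrite -[y in LHS]opprK pB -[- y]sub0r pB p0 sub0r opprK.
Qed.

Fact coind_scalerA a b phi :
  coind_scale a (coind_scale b phi) = coind_scale (a * b) phi.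
Proof. by apply/val_inj/funext => x /=; rewrite mulrA. Qed.
Fact coind_scale1r : left_id 1 coind_scale.
Proof. by move=> phi; apply/val_inj/funext => x /=; rewrite mulr1. Qed.
Fact coind_scalerDr : right_distributive coind_scale +%R.
Proof. by move=> a f g; apply/val_inj/funext. Qed.
Fact coind_scalerDl phi : {morph coind_scale^~ phi : a b / a + b}.
Proof. by move=> a b; apply/val_inj/funext => x /=; rewrite mulrDr coindD. Qed.

HB.instance Definition _ := GRing.Zmodule_isLmodule.Build R coind
  coind_scalerA coind_scale1r coind_scalerDr coind_scalerDl.

Lemma coindZE a (phi : coind) x : (a *: phi) x = phi (x * a).
Proof. by []. Qed.

Hypothesis ee : e * e = e.

Lemma coind_zero_module : zero_module coind -> e = 0.
Proof.
have ce : (fun x => e * x) \in corner_maps.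
  apply/asboolP; split=> [x y|x|r x]; first exact: mulrBr.
    by rewrite mulrA ee.
  by rewrite !mulrA.
by move/(_ (Coind ce))/(congr1 (fun phi : coind => phi 1)) => /=; rewrite mulr1.
Qed.

(** Coinduction is right adjoint to N |-> e N, by evaluation at 1.  A map
T -> coind thus corresponds to a map from e T = 0, and a cocycle on Q 1 to a
map on e (Q 1) that kills the kernel of e (Q 1) -> e (Q 0); this last map is
onto as e T = 0, so the cocycle factors through it. *)
Lemma coind_perp (T : lmodType R) : ann T e -> perp01 T coind.
Proof.
move=> Te; split=> [f t|Q f fd].
  apply/val_inj/funext => x; have [_ pe _] := coindP (f t).
  by rewrite -[LHS]/(f t x) -pe -[_ * x]mul1r -coindZE -linearZ /= -scalerA Te linear0.
have /choice[s sE] (z : Q 0%N) : exists y, res_d Q 0 y = e *: z.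
  by apply: (@res_exact0 R T Q (e *: z)).1; rewrite linearZ /=; apply: Te.
have fE y y' : res_d Q 0 y = res_d Q 0 y' -> f y = f y'.
  move=> yy; apply/eqP; rewrite -subr_eq0 -linearB; apply/eqP.
  have [|z <-] := (@res_exact R T Q 0 (y - y')).1; first by rewrite linearB /= yy subrr.
  exact: fd.
(* The extension is the adjoint of e (Q 0) -> eR obtained from f; the section s
   need not be additive, but f (s _) is, by fE. *)
pose g0 q (r : R) := f (s (r *: q)) 1.
have g0P q : g0 q \in corner_maps.
  apply/asboolP; split=> [r r'|r|r r'].
  - rewrite /g0 -[RHS]/((f (s (r *: q)) - f (s (r' *: q))) 1) -linearB.
    by congr (coind_val _ 1); apply: fE; rewrite linearB /= !sE -scalerBr -scalerBl.
  - by congr (coind_val _ 1); apply: fE; rewrite !sE !scalerA mulrA ee.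
  rewrite /g0; have [_ pe pl] := coindP (f (s (r' *: q))).
  have -> : f (s ((r * e * r') *: q)) = (e * r * e) *: f (s (r' *: q)).
    rewrite -linearZ; apply: fE.
    by rewrite linearZ /= !sE !scalerA -!mulrA (mulrA e e) ee.
  by rewrite coindZE mul1r -mulrA pe -[r * e]mulr1 pl.
have lg : linear (fun q => Coind (g0P q)).
  move=> a q q'; apply/val_inj/funext => r /=.
  rewrite -[RHS]/(g0 q (r * a) + g0 q' r) /g0.
  rewrite -[RHS]/((f (s ((r * a) *: q)) + f (s (r *: q'))) 1) -linearD.
  by congr (coind_val _ 1); apply: fE;
    rewrite linearD /= !sE -scalerDr -scalerA -scalerDr.
exists (linear_pack lg) => x; apply/val_inj/funext => r /=.
rewrite /g0 (fE (s (r *: res_d Q 0 x)) ((e * r) *: x)).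
  have [_ pe _] := coindP (f x).
  by rewrite linearZ coindZE mul1r pe.
by rewrite sE linearZ /= scalerA.
Qed.

End Coinduced.

(** * Presentations, the class D_s and Ext^1 *)

Section Presentations.
Variable R : pzRingType.
Implicit Types L M N P T X : lmodType R.

Lemma projective_surjection (pR : left_perfect R) M :
  exists (P : lmodType R) (p : {linear P -> M}), projective P /\ surjective p.
Proof. by have [P [p [pP sp _]]] := pR M; exists P, p. Qed.

(** A step of a projective resolution.  In [syzygy] the codomain of the new
step is the domain of the old one by computation, so that iterating it gives a
sequence of composable maps without any cast. *)
Record proj_arrow := ProjArrow {
  arrow_dom : lmodType R;
  arrow_cod : lmodType R;
  arrow :> {linear arrow_dom -> arrow_cod};
  arrow_cod_proj : projective arrow_cod;
  arrow_dom_proj : projective arrow_dom }.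

Lemma syzygy_exists (pR : left_perfect R) (s : proj_arrow) :
  {P : {P : lmodType R & {linear P -> arrow_dom s}} |
    projective (tag P) /\ exact_at (tagged P) s}.
Proof.
apply: cid; have [K [i [inji iE]]] := submodule_exists (is_submod_ker s).
have [P [p [pP sp]]] := projective_surjection pR K.
exists (Tagged (fun P : lmodType R => {linear P -> arrow_dom s})
  (i \o p : {linear P -> arrow_dom s})); split=> //= x.
split=> [/iE[k <-]|[y <-]]; last by apply/iE; exists (p y).
by have [y <-] := sp k; exists y.
Qed.

Definition syzygy (pR : left_perfect R) (s : proj_arrow) : proj_arrow :=
  let P := syzygy_exists pR s in
  ProjArrow (tagged (sval P)) (@arrow_dom_proj s) (proj1 (svalP P)).

(** The presentation s is continued to a full projective resolution of T, for
which f is a cocycle. *)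
Lemma Ext1_zero_extend (pR : left_perfect R) T (P1 P0 : lmodType R)
    (s : {linear P1 -> P0}) (p : {linear P0 -> T}) :
    projective P1 -> projective P0 -> exact_at s p -> surjective p ->
  forall M, Ext1_zero T M -> forall f : {linear P1 -> M},
    (forall x, s x = 0 -> f x = 0) ->
    exists g : {linear P0 -> M}, forall x, f x = g (s x).
Proof.
move=> pP1 pP0 es sp M ext f fs.
pose st n := iter n (syzygy pR) (ProjArrow s pP0 pP1).
have ex n : exact_at (arrow (st n.+1)) (arrow (st n)).
  exact: (svalP (syzygy_exists pR (st n))).2.
pose Q := @ProjResolution R T (fun n => arrow_cod (st n)) (fun n => arrow (st n)) p
  (fun n => @arrow_cod_proj (st n)) sp es ex.
apply: (ext Q f) => x; apply: fs; apply/(ex 0%N).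
by exists x.
Qed.

(** Ext^1(T, X) is computed by any resolution Q, while the hypothesis bears on
the presentation s.  A comparison map u : s -> Q over T turns the cocycle f into
a map on P1, which factors through s; a map v0 : Q 0 -> P0 over T and a homotopy
h from u0 v0 to the identity bring this factorization back to Q. *)
Lemma D_class_Ext1 T (P1 P0 : lmodType R) (s : {linear P1 -> P0}) X :
  proj_presentation s T -> D_class s X -> Ext1_zero T X.
Proof.
move=> [pP1 pP0 [p [es sp]]] DX Q f fd.
have [u0 u0E] : exists u : {linear P0 -> Q 0%N}, forall x, res_aug Q (u x) = p x.
  by apply: projective_lift => // x; apply: res_aug_surj.
have [v0 v0E] : exists v : {linear Q 0%N -> P0}, forall x, p (v x) = res_aug Q x.
  by apply: projective_lift; [exact: res_proj | move=> x; apply: sp].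
have [u1 u1E] : exists u : {linear P1 -> Q 1%N}, forall x, res_d Q 0 (u x) = u0 (s x).
  apply: (@projective_lift R P1 _ _ _ (u0 \o s)) => // x.
  by apply: (@res_exact0 R T Q _).1; rewrite /= u0E; apply/es; exists x.
have [h hE] : exists h : {linear Q 0%N -> Q 1%N},
    forall x, res_d Q 0 (h x) = u0 (v0 x) - x.
  apply: (@projective_lift R (Q 0%N) _ _ _ (u0 \o v0 \- idfun)) => [|x].
    exact: res_proj.
  by apply: (@res_exact0 R T Q _).1; rewrite linearB /= u0E v0E subrr.
have [g gE] := DX (f \o u1).
exists ((g \o v0) \- (f \o h)) => x /=.
have [|y yE] := (es (v0 (res_d Q 0 x))).1.
  by rewrite v0E; apply/(@res_exact0 R T Q _); exists x.
have gy : g (s y) = f (u1 y) := gE y.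
rewrite -yE gy -linearB; apply/eqP; rewrite -subr_eq0 -linearB; apply/eqP.
have [|z <-] := (@res_exact R T Q 0 (x - (u1 y - h (res_d Q 0 x)))).1; last exact: fd.
by rewrite !linearB /= hE u1E yE opprK addKr subrr.
Qed.

Lemma D_class_image (P1 P0 : lmodType R) (s : {linear P1 -> P0}) M N
    (p : {linear M -> N}) :
  projective P1 -> surjective p -> D_class s M -> D_class s N.
Proof.
move=> pP1 sp DM f; have [h hE] := pP1 _ _ p f sp.
have [g gE] := DM h; exists (p \o g) => x.
by rewrite -hE /= -gE.
Qed.

(** Lifting along p, which is possible on the projective module P0, makes any
map P1 -> M agree modulo the kernel of p with one that extends along s. *)
Lemma D_class_extension (P1 P0 : lmodType R) (s : {linear P1 -> P0}) M N
    (p : {linear M -> N}) :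
  projective P0 -> surjective p -> D_class s N ->
  (forall f : {linear P1 -> M}, (forall x, p (f x) = 0) ->
    exists g : {linear P0 -> M}, g \o s =1 f) -> D_class s M.
Proof.
move=> pP0 sp DN Dk f; have [g gE] := DN (p \o f).
have [h hE] := pP0 _ _ p g sp.
have [|k kE] := Dk (f \- (h \o s)).
  by move=> x /=; rewrite linearB /= [p (h _)]hE [g _]gE subrr.
exists (h \+ k) => x /=; have /= -> := kE x.
by rewrite addrC subrK.
Qed.

End Presentations.

(** * The equivalence *)

Section Main.
Variables (R : pzRingType) (T P1 P0 : lmodType R) (s : {linear P1 -> P0}).
Hypotheses (pT : proj_presentation s T)
  (GD : forall M : lmodType R, Gen T M -> D_class s M).

(** Given f : T -> X / S, the composite P0 -> T -> X / S lifts to h : P0 -> X,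
and h s takes its values in the trace S.  As S lies in D_s, correcting h by a
map into S gives a map T -> X lifting f; its values lie in S, so f = 0. *)
Lemma Hom_zero_mod_trace (X S : lmodType R) (i : {linear S -> X}) :
  injective i -> Gen T S -> (forall (f : {linear T -> X}) t, exists y, i y = f t) ->
  forall (N : lmodType R) (q : {linear X -> N}), surjective q ->
    (forall x, q x = 0 <-> exists y, i y = x) -> Hom_zero T N.
Proof.
move=> inji GS iT N q sq kq f t.
have [pP1 pP0 [p [es sp]]] := pT.
have [h hE] := pP0 _ _ q (f \o p) sq.
have [k kE] : exists k : {linear P1 -> S}, forall x, i (k x) = h (s x).
  apply: (@factor_injective R P1 _ _ i (h \o s)) => // x.
  have ps : p (s x) = 0 by apply/es; exists x.
  by apply/kq; rewrite [q _]hE /= ps linear0.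
have [g gE] := GD GS k.
have [h' h'E] : exists h' : {linear T -> X}, forall z, h' (p z) = h z - i (g z).
  apply: (@factor_surjective R P0 _ _ p (h \- (i \o g))) => // z /es[x <-] /=.
  by rewrite [g _]gE kE subrr.
have [z <-] := sp t; have [y yE] := iT h' (p z).
have qig : q (i (g z)) = 0 by apply/kq; exists (g z).
have : q (h z - i (g z)) = 0 by apply/kq; exists y; rewrite yE h'E.
by rewrite linearB /= qig subr0 => qh; rewrite -[LHS](hE z).
Qed.

(** If X is in D_s then so is its quotient by the trace of T, which is therefore
orthogonal to T, hence zero. *)
Lemma D_class_Gen (M : lmodType R) :
  (forall N : lmodType R, perp01 T N -> zero_module N) ->
  D_class s M -> Gen T M.
Proof.
move=> perp0 DM; have [S [i [inji GS iT]]] := trace_Gen T M.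
have [N [q [sq kq]]] := quotient_exists (is_submod_range i).
have zN : zero_module N.
  apply: perp0; split; first exact: (Hom_zero_mod_trace inji GS iT sq kq).
  apply: (D_class_Ext1 pT); case: pT => pP1 _ _.
  exact: (D_class_image pP1 sq DM).
by apply: (@Gen_image _ _ _ _ i) GS => x; apply/kq/zN.
Qed.

Hypothesis pR : left_perfect R.
Hypothesis DG : forall M : lmodType R, D_class s M -> Gen T M.

(** For x in the kernel of s, each coordinate of x on a dual basis of P1 kills
T: for t in T the map P1 -> T given by this coordinate times t factors through
s, since T is in D_s. *)
Lemma presentation_ker_ann (M : lmodType R) (f : {linear P1 -> M}) :
  (forall x a, ann T a -> a *: f x = 0) -> forall x, s x = 0 -> f x = 0.
Proof.
move=> Af x sx; case: pT => pP1 _ _; have [c cE] := dual_basis pP1.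
have [r ur rE] := dsum_supp (c x).
rewrite (cE x r ur rE) linear_sum big1 // => j _; rewrite linearZ; apply: Af => t.
have [g gE] := GD (Gen_self T) (linear_pack (linear_scaler t) \o
  (linear_pack (@dsum_coord_linear R P1 R^o j) \o c)).
by rewrite -[LHS](gE x) /= sx linear0.
Qed.

(** With U the submodule of elements killed by the annihilator of T, the
preimage V in M of the trace of T in M / U lies in D_s, hence in Gen T; this
forces V = 0 since Hom(T, M) = 0. *)
Lemma perp01_annihilated_eq0 (M : lmodType R) : perp01 T M ->
  forall m : M, (forall a, ann T a -> a *: m = 0) -> m = 0.
Proof.
case=> hM eM m0 Am0; have [pP1 pP0 [p [es sp]]] := pT.
pose U (m : M) := forall a, ann T a -> a *: m = 0.
have sU : is_submod U.
  split=> [a _|r x y Ux Uy a Aa]; first exact: scaler0.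
  rewrite scalerDr scalerA Ux ?Uy ?addr0 //.
  exact: (idealMr (ann_ideal T)).
have [N [q [sq kq]]] := quotient_exists sU.
have [S [i [inji GS iT]]] := trace_Gen T N.
have [V [j [injj jE]]] := submodule_exists (is_submod_preim q (is_submod_range i)).
have [pr prE] : exists pr : {linear V -> S}, forall v, i (pr v) = q (j v).
  apply: (@factor_injective R V _ _ i (q \o j)) => // v.
  by apply/jE; exists v.
have spr : surjective pr.
  move=> y; have [x xE] := sq (i y).
  have /jE[v vE] : exists z, i z = q x by exists y.
  by exists v; apply: inji; rewrite prE vE.
have DV : D_class s V.
  apply: (D_class_extension pP0 spr (GD GS)) => f prf.
  have Uf x : U (j (f x)) by apply/kq; rewrite -prE prf linear0.
  have [|g gE] := Ext1_zero_extend pR pP1 pP0 es sp eM (f := j \o f).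
    by apply: presentation_ker_ann => x a Aa; apply: Uf.
  have [k kE] : exists k : {linear T -> N}, forall z, k (p z) = q (g z).
    apply: (@factor_surjective R P0 _ _ p (q \o g)) => // z /es[x <-].
    by apply/kq; rewrite -gE; apply: Uf.
  have [g' g'E] : exists g' : {linear P0 -> V}, forall z, j (g' z) = g z.
    by apply: factor_injective => // z; apply/jE; rewrite -kE; apply: iT.
  by exists g' => x; apply: injj; rewrite /= g'E -gE.
have jV := Gen_Hom_zero (DG DV) hM j.
have /jE[v <-] : exists y, i y = q m0; last exact: jV.
by exists 0; rewrite linear0; apply/esym/kq.
Qed.

End Main.

Theorem theorem3p7 (R : pzRingType) (T : lmodType R) :
  perfect R ->
  (sincere T /\ silting T <->
   presilting T /\ (forall M : lmodType R, perp01 T M -> zero_module M)).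
Proof.
case=> pR rpR; split.
  case=> sT [P1 [P0 [s [pT GD]]]]; split.
    by exists P1, P0, s; split=> // M /GD.
  move=> M TM.
  apply: (right_perfect_annihilated_eq0 rpR (ann_ideal T)).
    exact: no_idempotent_of_sincere.
  by apply: (perp01_annihilated_eq0 pT _ pR _ TM) => N /GD.
case=> [[P1 [P0 [s [pT GD]]]] perp0]; split; last first.
  exists P1, P0, s; split=> // M; split; first exact: GD.
  exact: (D_class_Gen pT GD perp0).
apply: (sincere_of_no_idempotent pR) => e Te ee.
by apply: (coind_zero_module ee); apply/perp0/coind_perp.
Qed.
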